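(* Let $K^*$ be an exponentially stabilizing controller, let $\phi(\omega)=\overline\sigma\big(T_{wz}(P(j\omega),K^*(j\omega))\big)$, $\omega\in[0,\infty]$, and let $\vartheta_0>0$ be such that $\phi$ is of class $C^2$ on $\{\omega:\phi(\omega)>\|T_{wz}(P,K^* )\|_\infty-\vartheta_0\}$. Let $0<\vartheta\le\vartheta_0$. Let $\Omega_{\mathrm{opt}}\subset[0,\infty]$ be a finite grid and $\gamma^*=\max_{\omega\in\Omega_{\mathrm{opt}}}\phi(\omega)$ the gain achieved by $K^*$ on $\Omega_{\mathrm{opt}}$. Let $L[\cdot,\cdot]$ be a first-order bound for $\phi$, and let $\Omega_{\mathrm{ver}}=\{0=\omega_0<\omega_1<\dots<\omega_N=\infty\}\supseteq\Omega_{\mathrm{opt}}$ be a refined finite grid such that for every pair of consecutive nodes $$L[\omega_i,\omega_{i+1}]\,(\omega_{i+1}-\omega_i)<2\gamma^*+2\vartheta-\phi(\omega_i)-\phi(\omega_{i+1}),$$ and suppose that the verification test $$\gamma^*\ \ge\ \max_{\omega\in\Omega_{\mathrm{ver}}}\phi(\omega)-\vartheta$$ is passed. Then $$\gamma^*\ \ge\ \|T_{wz}(P,K^* )\|_\infty-\vartheta .$$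
   Context: $P(s)$ is the transfer function of a plant in which the (possibly infinite-dimensional) system $G(s)$ is embedded, $T_{wz}(P,K)$ is the matrix-valued closed-loop transfer function of the performance/robustness channel $w\to z$ obtained by closing the loop of $P$ with the controller $K$, $\overline\sigma$ is the maximum singular value, and $\|T_{wz}(P,K)\|_\infty=\max_{\omega\in[0,\infty]}\overline\sigma(T_{wz}(P(j\omega),K(j\omega)))$. The function $\omega\mapsto T_{wz}(P(j\omega),K^*(j\omega))$ is real analytic on $[0,\infty)$ and continuous at $\infty$; $\phi$ is then locally a finite maximum of real-analytic functions and has only finitely many points of non-smoothness. A first-order bound $L[\cdot,\cdot]$ for $\phi$ satisfies $L[\omega^-,\omega^+]\ge|\phi'(\omega)|$ for every $\omega\in[\omega^-,\omega^+]$ at which $\phi$ is differentiable. For the last interval ($\omega_N=\infty$) the product on the left-hand side of the grid condition is taken in $[0,\infty]$ with $0\cdot\infty=0$. The pair of conditions on $\Omega_{\mathrm{ver}}$ is the exit situation of the paper's synthesis algorithm: $K^*$ is computed as a locally optimal controller minimizing $\max_{\omega\in\Omega_{\mathrm{opt}}}\overline\sigma(T_{wz}(P(j\omega),K(j\omega)))$ over stabilizing controllers $K$ of a prescribed structure, the grid is completed to $\Omega_{\mathrm{ver}}$ so that the first-order grid condition holds, and the algorithm terminates when the verification test is passed. *)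

(* Defs.v *)
From HB Require Import structures.
From mathcomp Require Import all_boot all_order all_algebra.
From mathcomp Require Import all_classical all_reals all_analysis.
From mathcomp Require Import complex.

Set Implicit Arguments.
Unset Strict Implicit.
Unset Printing Implicit Defensive.

Import Order.TTheory GRing.Theory Num.Theory.
Import numFieldNormedType.Exports.
Local Open Scope classical_set_scope.
Local Open Scope complex_scope.
Local Open Scope ring_scope.
Local Open Scope sesquilinear_scope.

(* The topology of the modulus on R[i], as for abstract number fields. *)
#[non_forgetful_inheritance]
HB.instance Definition _ (R : rcfType) :=
  PseudoPointedMetric.copy R[i] R[i]^o.
#[non_forgetful_inheritance]
HB.instance Definition _ (R : rcfType) := GRing.ComAlgebra.copy R[i] R[i]^o.
#[non_forgetful_inheritance]
HB.instance Definition _ (R : rcfType) := Vector.copy R[i] R[i]^o.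
#[non_forgetful_inheritance]
HB.instance Definition _ (R : rcfType) := NormedModule.copy R[i] R[i]^o.

(* The nonnegative square roots of the eigenvalues of A^* A.  The set may
   contain an extra 0 (when A has more columns than rows), which does not affect
   the maximum; it is finite, so its supremum is a maximum. *)
Definition singular_values (R : realType) (m n : nat) (A : 'M[R[i]]_(m, n)) :
    set R :=
  [set s | 0 <= s /\ eigenvalue (A^t* *m A) ((s ^+ 2)%:C)].

Definition sigma_max (R : realType) (m n : nat) (A : 'M[R[i]]_(m, n)) : R :=
  sup (singular_values A).

Section ClosedLoop.
Variables (R : realType) (nz ny nw nu : nat).
Implicit Types (P : R[i] -> 'M[R[i]]_(nz + ny, nw + nu)).
Implicit Types (K : R[i] -> 'M[R[i]]_(nu, ny)).

(* z = P11 w + P12 u, y = P21 w + P22 u, u = K y *)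
Definition lft (A : 'M[R[i]]_(nz + ny, nw + nu)) (B : 'M[R[i]]_(nu, ny)) :
    'M[R[i]]_(nz, nw) :=
  ulsubmx A
  + ursubmx A *m B *m invmx (1%:M - drsubmx A *m B) *m dlsubmx A.

(* The value at s of the closed-loop transfer function.  Wherever P and K are
   regular and the loop is well posed, this is just lft (P s) (K s); the limit
   removes the removable singularities which lft (P s) (K s) has at the poles of
   P and K that are cancelled by closing the loop. *)
Definition Twz P K (s : R[i]) : 'M[R[i]]_(nz, nw) :=
  lim (lft (P s') (K s') @[s' --> s^']).

End ClosedLoop.

Section Stability.
Variables (R : realType) (nz ny nw nu : nat).
Implicit Types (P : R[i] -> 'M[R[i]]_(nz + ny, nw + nu)).
Implicit Types (K : R[i] -> 'M[R[i]]_(nu, ny)).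

(* The plant with additional inputs d1, d2 and outputs u, y, where
   u = K y + d1 and y = P21 w + P22 u + d2:
   the closed loop of extended_plant P with K maps (w, d1, d2) to (z, u, y). *)
Definition extended_plant (A : 'M[R[i]]_(nz + ny, nw + nu)) :
    'M[R[i]]_((nz + (nu + ny)) + ny, (nw + (nu + ny)) + nu) :=
  let P11 := ulsubmx A in let P12 := ursubmx A in
  let P21 := dlsubmx A in let P22 := drsubmx A in
  block_mx
    (block_mx P11 (row_mx P12 0) (col_mx 0 P21) (block_mx 1%:M 0 P22 1%:M))
    (col_mx P12 (col_mx 1%:M P22))
    (row_mx P21 (row_mx P22 1%:M))
    P22.

(* All the closed-loop transfer functions of (P, K), internal ones included, are
   holomorphic and bounded on some half-plane Re s > - alpha with alpha > 0. *)
Definition exponentially_stabilizing P K : Prop :=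
  exists alpha : R, 0 < alpha /\
  exists H : R[i] -> 'M[R[i]]_(nz + (nu + ny), nw + (nu + ny)),
    [/\ forall s : R[i], - alpha < complex.Re s ->
          (\forall s' \near s^',
             (1%:M - drsubmx (P s') *m K s') \in unitmx) /\
          lft (extended_plant (P s')) (K s') @[s' --> s^'] --> H s,
        forall s : R[i], - alpha < complex.Re s ->
          forall i j, derivable (fun s' => H s' i j) s 1
      & exists M : R, forall s : R[i], - alpha < complex.Re s ->
          forall i j, `|H s i j| <= M%:C].

End Stability.

Section FrequencyResponse.
Variables (R : realType) (nz ny nw nu : nat).
Variables (P : R[i] -> 'M[R[i]]_(nz + ny, nw + nu)).
Variables (K : R[i] -> 'M[R[i]]_(nu, ny)).

(* omega |-> Twz(P(j omega), K(j omega)) on [0, +oo]; the value at -oo is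
   irrelevant. *)
Definition freq_response (w : \bar R) : 'M[R[i]]_(nz, nw) :=
  match w with
  | r%:E => Twz P K (r *i)
  | +oo%E => lim (Twz P K (r *i) @[r --> +oo])
  | -oo%E => 0
  end.

Definition freq_gain (w : \bar R) : R := sigma_max (freq_response w).

Definition Hinf_norm : R := sup (freq_gain @` [set w | (0 <= w)%E]).

Definition freq_continuous_at_infty : Prop :=
  cvg (Twz P K (r *i) @[r --> +oo]).

Definition freq_real_analytic : Prop :=
  forall w0 : R, 0 <= w0 ->
  exists (r : R) (a : nat -> 'M[R[i]]_(nz, nw)), 0 < r /\
    forall w : R, 0 <= w -> `|w - w0| < r ->
      series (fun n => ((w - w0) ^+ n)%:C *: a n) @ \oo
        --> freq_response w%:E.

End FrequencyResponse.

(* Derivative relative to [0, +oo[: two-sided at x > 0, one-sided at 0. *)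
Definition has_deriv (R : realType) (f : R -> R) (x d : R) : Prop :=
  (f y - f x) / (y - x) @[y --> within `[0, +oo[ x^'] --> d.

(* D is meant to be a relatively open subset of [0, +oo[. *)
Definition C2_on (R : realType) (D : set R) (f : R -> R) : Prop :=
  exists f1 f2 : R -> R,
    [/\ forall x, D x -> has_deriv f x (f1 x),
        forall x, D x -> has_deriv f1 x (f2 x)
      & {within D, continuous f2}].

(* L takes values in [0, +oo]; its arguments are the end points of a
   subinterval of [0, +oo]. *)
Definition first_order_bound (R : realType) (phi : \bar R -> R)
    (L : \bar R -> \bar R -> \bar R) : Prop :=
  forall a b : \bar R, (0 <= a)%E -> (a < b)%E ->
    (0 <= L a b)%E /\
    forall w d : R, (a <= w%:E <= b)%E ->
      has_deriv (fun x => phi x%:E) w d -> (`|d|%:E <= L a b)%E.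

(* Maximum over a nonempty grid of a function with nonnegative values. *)
Definition grid_max (R : realType) (phi : \bar R -> R) (s : seq (\bar R)) : R :=
  \big[Num.max/0]_(w <- s) phi w.

(* Main.v *)
Require Import Defs.
From HB Require Import structures.
From mathcomp Require Import all_boot all_order all_algebra.
From mathcomp Require Import all_classical all_reals all_analysis.
From mathcomp Require Import complex ring lra.

(* The maximum singular value is a maximum of real linear functionals of the
   matrix, so phi has at each omega0 > 0 a supporting function from below,
   Re (u^* T v) with u, v fixed, which is differentiable.  If
   phi b - phi a > L (b - a), then phi can also be touched from above at an
   interior point by a smooth function of slope greater than L; there phi is
   squeezed between two tangent functions, hence differentiable with derivative
   greater than L.  Thus a first-order bound for phi at its points of
   differentiability is a Lipschitz bound, however many
   points of non-smoothness there are.  The Lipschitz bound from both end points of a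
   grid interval and the grid condition give 2 phi < 2 gamma + 2 theta between
   the nodes; on the last, unbounded interval the grid condition forces L = 0. *)

Set Implicit Arguments.
Unset Strict Implicit.
Unset Printing Implicit Defensive.

Import Order.TTheory GRing.Theory Num.Theory.
Import numFieldNormedType.Exports.
Local Open Scope classical_set_scope.
Local Open Scope ring_scope.

(** * The maximum singular value as a maximum of linear functionals *)

Section SigmaMax.
Local Open Scope complex_scope.
Local Open Scope sesquilinear_scope.
Variable R : realType.
Implicit Types m n : nat.

Definition sqnorm n (x : 'cV[R[i]]_n) : R[i] := \sum_i `|x i 0| ^+ 2.

Lemma sqnorm_ge0 n (x : 'cV[R[i]]_n) : 0 <= sqnorm x.
Proof. by apply: sumr_ge0 => i _; rewrite exprn_ge0. Qed.

Lemma sqnormE n (x : 'cV[R[i]]_n) : (x^t* *m x) 0 0 = sqnorm x.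
Proof.
by rewrite mxE; apply: eq_bigr => i _; rewrite !mxE normCKC.
Qed.

Lemma sqnorm_eq0 n (x : 'cV[R[i]]_n) : sqnorm x = 0 -> x = 0.
Proof.
move/eqP; rewrite psumr_eq0; last by move=> i _; rewrite exprn_ge0.
move=> /allP x0; apply/matrixP => i j; rewrite (ord1 j) mxE; apply/eqP.
by rewrite -normr_eq0 -sqrf_eq0; apply: (implyP (x0 i _)); rewrite ?mem_index_enum.
Qed.

Lemma trmxC_mul m n p (A : 'M[R[i]]_(m, n)) (B : 'M[R[i]]_(n, p)) :
  (A *m B)^t* = B^t* *m A^t*.
Proof. by rewrite trmx_mul map_mxM. Qed.

Lemma sqnorm_mulmx m n (A : 'M[R[i]]_(m, n)) (x : 'cV[R[i]]_n) :
  sqnorm (A *m x) = (x^t* *m (A^t* *m A) *m x) 0 0.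
Proof. by rewrite -sqnormE trmxC_mul !mulmxA. Qed.

Lemma sqnorm_unitary n (U : 'M[R[i]]_n) (x : 'cV[R[i]]_n) :
  U \is unitarymx -> sqnorm (U *m x) = sqnorm x.
Proof.
move=> Uu; rewrite sqnorm_mulmx -(invmx_unitary Uu).
by rewrite mulVmx ?unitarymx_unit// mulmx1 sqnormE.
Qed.

Lemma complex_ge0P (x : R[i]) : 0 <= x -> exists2 r : R, 0 <= r & x = r%:C.
Proof.
move=> x0; exists (complex.Re x); last by rewrite RRe_real// ger0_real.
by move: x0; rewrite lecE => /andP[].
Qed.

(** By the spectral theorem the Hermitian matrix [A^t* *m A] has a unitary eigenbasis, and its
    quadratic form is a sum of squared coordinates weighted by the eigenvalues; the largest weight
    bounds it. The eigenvector appears as a row because [eigenvalue] refers to row vectors. *)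
Lemma gram_max_eigenvector m n (A : 'M[R[i]]_(m, n.+1)) :
  exists (v : 'cV[R[i]]_n.+1) (s : R),
    [/\ 0 <= s, sqnorm v = 1,
        v^t* *m (A^t* *m A) = (s ^+ 2)%:C *: v^t*
      & forall x, sqnorm (A *m x) <= (s ^+ 2)%:C * sqnorm x].
Proof.
set M := A^t* *m A.
have MC : M^t* = M by rewrite trmxC_mul trmxCK.
have /orthomx_spectralP : M \is normalmx by apply/normalmxP; rewrite MC.
set U := spectralmx M; set D := spectral_diag M => MUD.
have Uu : U \is unitarymx := spectral_unitarymx M.
have UM : U *m M = diag_mx D *m U.
  by rewrite MUD !mulmxA mulmxV ?unitarymx_unit// mul1mx.
pose e k : 'cV[R[i]]_n.+1 := (row k U)^t*.
have eM k : (e k)^t* *m M = D 0 k *: (e k)^t*.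
  by rewrite trmxCK -row_mul UM row_mul row_diag_mx -scalemxAl -rowE.
have e1 k : sqnorm (e k) = 1.
  rewrite -sqnormE trmxCK; transitivity ((U *m U^t*) k k).
    by rewrite !mxE; apply: eq_bigr => i _; rewrite !mxE.
  by rewrite (unitarymxP Uu) mxE eqxx.
(* Being squared norms, the eigenvalues are real and nonnegative, hence squares of real numbers. *)
have De k : D 0 k = sqnorm (A *m e k).
  by rewrite sqnorm_mulmx eM -scalemxAl mxE sqnormE e1 mulr1.
have Dr k : exists2 r : R, 0 <= r & D 0 k = (r ^+ 2)%:C.
  have [r r0 rE] := complex_ge0P (sqnorm_ge0 (A *m e k)).
  exists (Num.sqrt r); first exact: sqrtr_ge0.
  by rewrite De rE sqr_sqrtr.
have [r r0 rE] : exists2 r : 'I_n.+1 -> R,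
    (forall k, 0 <= r k) & forall k, D 0 k = (r k ^+ 2)%:C.
  by exists (fun k => s2val (cid2 (Dr k))) => k; case: (cid2 (Dr k)).
have [k _ kmax] : exists2 k, true & forall j, r j <= r k.
  by case: (@arg_maxP _ R 'I_n.+1 ord0 xpredT r) => // k _ km; exists k => // j; apply: km.
exists (e k), (r k); split; rewrite ?e1 ?eM ?rE//.
move=> x; rewrite sqnorm_mulmx -/M MUD invmx_unitary//.
set y := U *m x.
have -> : x^t* *m (U^t* *m diag_mx D *m U) *m x = y^t* *m diag_mx D *m y.
  by rewrite trmxC_mul !mulmxA.
rewrite -(sqnorm_unitary x Uu) -/y mxE mulr_sumr; apply: ler_sum => j _.
rewrite mul_mx_diag !mxE rE mulrAC -normCKC mulrC.
by rewrite ler_wpM2r ?exprn_ge0// lecR lerXn2r ?nnegrE.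
Qed.

(** Identifies [sigma_max] with the attained operator norm. Asking [sqnorm v <= 1] instead of
    equality covers matrices without columns. *)
Lemma sigma_maxP m n (A : 'M[R[i]]_(m, n)) :
  [/\ 0 <= sigma_max A,
      exists2 v : 'cV[R[i]]_n,
        sqnorm v <= 1 & sqnorm (A *m v) = (sigma_max A ^+ 2)%:C
    & forall x : 'cV[R[i]]_n,
        sqnorm (A *m x) <= (sigma_max A ^+ 2)%:C * sqnorm x].
Proof.
case: n => [|n] in A *.
  (* Without columns there is no nonzero eigenvector, so the supremum is that of the empty set,
     which is 0 by default. *)
  have -> : sigma_max A = 0.
    rewrite /sigma_max (_ : singular_values A = set0) ?sup0//.
    apply/seteqP; split=> // s [_ /eigenvalueP[v _]].
    by rewrite (thinmx0 v) eqxx.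
  have A0 x : sqnorm (A *m x) = 0.
    by rewrite (thinmx0 A) mul0mx /sqnorm big1// => i _; rewrite mxE normr0 expr0n.
  split=> //; last by move=> x; rewrite A0 expr0n mul0r.
  by exists 0; rewrite ?A0 ?expr0n// /sqnorm big_ord0 ler01.
have [v [s [s0 v1 vM sA]]] := gram_max_eigenvector A.
have -> : sigma_max A = s.
  have sin : singular_values A s.
    split=> //; apply/eigenvalueP; exists (v^t* ); first exact: vM.
    apply/eqP => v0; move: v1; rewrite -sqnormE v0 mul0mx mxE => /esym/eqP.
    by rewrite oner_eq0.
  (* An eigenvector for [t ^+ 2], inserted in the operator bound [sA], gives [t ^+ 2 <= s ^+ 2]. *)
  have sub : ubound (singular_values A) s.
    move=> t [t0 /eigenvalueP[w wM w0]].
    have := sA (w^t* ); rewrite sqnorm_mulmx trmxCK wM -scalemxAl mxE.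
    rewrite -[X in X *m _]trmxCK sqnormE ler_pM2r.
      by rewrite lecR ler_pXn2r// nnegrE.
    rewrite lt0r sqnorm_ge0 andbT; apply: contra w0 => /eqP/sqnorm_eq0 w0.
    by rewrite -(trmxCK w) w0 trmx0 map_mx0.
  by apply/eqP; rewrite eq_le ge_sup ?ub_le_sup//; exists s.
split=> //; exists v; rewrite ?v1//.
by rewrite sqnorm_mulmx vM -scalemxAl mxE sqnormE v1 mulr1.
Qed.

Lemma le_sigma_max m n (A : 'M[R[i]]_(m, n)) (u : 'cV_m) (v : 'cV_n) :
  sqnorm u <= 1 -> sqnorm v <= 1 ->
  complex.Re ((u^t* *m A *m v) 0 0) <= sigma_max A.
Proof.
move=> u1 v1; have [s0 _ /(_ v) Av] := sigma_maxP A.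
have Av1 : sqnorm (A *m v) <= (sigma_max A ^+ 2)%:C.
  by rewrite (le_trans Av)// ler_piMr// lecR sqr_ge0.
set z := (u^t* *m A *m v) 0 0.
have zE : z = dotmx (u^t* ) ((A *m v)^t* ).
  by rewrite dotmxE trmxCK mulmxA.
have : `|z| ^+ 2 <= (sigma_max A ^+ 2)%:C.
  set x := u^t*; set y := (A *m v)^t*.
  have CS : `|dotmx x y| ^+ 2 <= dotmx x x * dotmx y y.
    by case: (CauchySchwarz (dotmx (n:=m)) x y).
  rewrite zE (le_trans CS)// !dotmxE !trmxCK !sqnormE.
  by rewrite (le_trans _ Av1)// ler_piMl// sqnorm_ge0.
rewrite rmorphXn/= ler_pXn2r ?nnegrE// ?lecR// => zs.
have := normc_ge_Re z; rewrite lecR => /le_trans /(_ zs).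
exact: le_trans (ler_norm _).
Qed.

(** With [v] maximizing and [u] the normalized image of [v], the functional Re (u^* B v) equals
    [sigma_max A] at [B = A] and never exceeds [sigma_max B], by Cauchy-Schwarz. Writing it through
    the coefficients [c] lets it be applied entry by entry to power series. *)
Lemma sigma_max_support m n (A : 'M[R[i]]_(m, n)) :
  exists c : 'M[R[i]]_(m, n),
    [/\ forall i j, Normc.normc (c i j) <= 1,
        complex.Re (\sum_i \sum_j c i j * A i j) = sigma_max A
      & forall B : 'M[R[i]]_(m, n),
          complex.Re (\sum_i \sum_j c i j * B i j) <= sigma_max B].
Proof.
have [s0 [v v1 Av] _] := sigma_maxP A.
have [u u1 uA] : exists2 u : 'cV[R[i]]_m, sqnorm u <= 1 &
    complex.Re ((u^t* *m A *m v) 0 0) = sigma_max A.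
  (* The image [A *m v] can be normalized only if [sigma_max A] is nonzero; otherwise [u = 0]
     serves. *)
  have [sE|sN0] := eqVneq (sigma_max A) 0.
    exists 0; rewrite /sqnorm.
      by rewrite big1 ?ler01// => i _; rewrite mxE normr0 expr0n.
    by rewrite trmx0 map_mx0 !mul0mx mxE sE.
  exists ((sigma_max A)^-1%:C *: (A *m v)).
    rewrite /sqnorm (eq_bigr (fun i => ((sigma_max A)^-1%:C) ^+ 2 * `|(A *m v) i 0| ^+ 2)).
      rewrite -mulr_sumr -/(sqnorm _) Av -rmorphXn/= -rmorphM/= exprVn mulVf//.
      by rewrite expf_neq0.
    move=> i _; rewrite mxE normrM exprMn.
    by rewrite (@ger0_norm _ (_%:C))// lecR invr_ge0.
  rewrite -mulmxA linearZ/= map_mxZ -scalemxAl mxE sqnormE Av.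
  have cr : ((sigma_max A)^-1%:C)^*%R = (sigma_max A)^-1%:C :> R[i].
    by apply: CrealP; rewrite realE lecR invr_ge0 s0.
  transitivity (complex.Re (((sigma_max A)^-1%:C)^*%R * (sigma_max A ^+ 2)%:C)) => //.
  by rewrite cr -rmorphM/= expr2 mulKf.
exists (\matrix_(i, j) ((u i 0)^*%R * v j 0)).
have E (B : 'M[R[i]]_(m, n)) : \sum_i \sum_j (\matrix_(i, j) ((u i 0)^*%R * v j 0)) i j * B i j
    = (u^t* *m B *m v) 0 0.
  rewrite mxE exchange_big/=; apply: eq_bigr => j _.
  rewrite mxE mulr_suml; apply: eq_bigr => i _.
  rewrite [in LHS]mxE [u^t* 0 i]mxE [u^T 0 i]mxE; exact: mulrAC.
have le1 p (x : 'cV[R[i]]_p) i : sqnorm x <= 1 -> `|x i 0| <= 1.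
  move=> x1; rewrite -(@expr_le1 _ 2)//; apply: le_trans x1.
  by rewrite /sqnorm (bigD1 i)//= lerDl sumr_ge0// => k _; rewrite exprn_ge0.
split=> [i j||B]; last 2 first.
- by rewrite E uA.
- by rewrite E; exact: le_sigma_max.
rewrite mxE -lecR.
have -> : (Normc.normc ((u i 0)^*%R * v j 0))%:C = `|(u i 0)^*%R * v j 0| by [].
by rewrite normrM norm_conjC mulr_ile1// le1.
Qed.

End SigmaMax.

(** * A mean value inequality for functions supported from below by tangent functions *)

Section MeanValue.
Variable R : realType.
Implicit Types (f g : R -> R) (a b x d L : R).

(** Differentiability with a quadratic remainder: analytic functions have it, and it allows slopes
    to be compared by explicit estimates. *)
Definition tangent_at f x d := exists C e : R, 0 < e /\
  forall h, `|h| < e -> `|f (x + h) - f x - d * h| <= C * h ^+ 2.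

Lemma tangent_at_comp_opp f x d :
  tangent_at f x d -> tangent_at (f \o -%R) (- x) (- d).
Proof.
move=> [C [e [e0 fe]]]; exists C, e; split=> // h he /=.
have := fe (- h); rewrite normrN sqrrN => /(_ he).
by rewrite opprD opprK mulrN mulNr.
Qed.

(* The slopes ds and du agree since s and the upper bound touch at x. *)
Lemma tangent_at_between (s f : R -> R) x ds du (C e : R) :
    tangent_at s x ds -> s x = f x -> 0 < e ->
    (forall h, `|h| < e -> s (x + h) <= f (x + h)) ->
    (forall h, `|h| < e -> f (x + h) - f x - du * h <= C * h ^+ 2) ->
  tangent_at f x du.
Proof.
move=> [C1 [e1 [e10 se]]] sx e0 sf fu.
have [D D0 [CD C1D]] : exists2 D, 0 < D & C <= D /\ C1 <= D.
  exists (`|C| + `|C1| + 1).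
    by have := normr_ge0 C; have := normr_ge0 C1; lra.
  have := ler_norm C; have := ler_norm C1.
  by have := normr_ge0 C; have := normr_ge0 C1; lra.
pose e2 := Num.min e e1.
have e20 : 0 < e2 by rewrite lt_min e0.
have low h : `|h| < e2 -> - (D * h ^+ 2) <= s (x + h) - f x - ds * h.
  rewrite lt_min => /andP[_ /se]; rewrite sx ler_norml => /andP[+ _].
  by have := ler_wpM2r (sqr_ge0 h) C1D; lra.
have upp h : `|h| < e2 -> f (x + h) - f x - du * h <= D * h ^+ 2.
  rewrite lt_min => /andP[/fu + _].
  by have := ler_wpM2r (sqr_ge0 h) CD; lra.
have key h : `|h| < e2 -> (ds - du) * h <= 2 * D * h ^+ 2.
  move=> he; have := low h he; have := upp h he.
  by move: he; rewrite lt_min => /andP[/sf]; lra.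
suff dE : ds = du.
  exists D, e2; split=> // h he; rewrite ler_norml upp// andbT.
  have := low h he; move: he; rewrite lt_min dE => /andP[/sf].
  by lra.
apply/eqP; rewrite -subr_eq0; apply: contraT => dd0.
(* Testing [key] at [k] and [- k], one of which makes its left side positive, gives
   [|ds - du| <= 2 * D * k], whereas this choice of [k] ensures [4 * D * k <= |ds - du|]. *)
pose k := Num.min (e2 / 2) (`|ds - du| / (4 * D)).
have k0 : 0 < k.
  by rewrite lt_min !divr_gt0 ?normr_gt0// mulr_gt0.
have ke : k < e2.
  by rewrite gt_min; apply/orP; left; lra.
have kD : 4 * D * k <= `|ds - du|.
  have : k <= `|ds - du| / (4 * D) by rewrite ge_min lexx orbT.
  by rewrite ler_pdivlMr ?mulr_gt0// mulrC.
have kp : `|k| < e2 by rewrite gtr0_norm.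
have kn : `|- k| < e2 by rewrite normrN.
have := key _ kp; have := key _ kn; rewrite sqrrN => H1 H2.
have : `|ds - du| * k <= 2 * D * k ^+ 2.
  by case: (ger0P (ds - du)) => _; lra.
rewrite expr2 mulrA ler_pM2r// => H3.
have : 0 < D * k by rewrite mulr_gt0.
by lra.
Qed.

(* At a maximum point c of (b - x) (f x - f a - L (x - a)), f is touched from
   above by f a + L (x - a) + m / (b - x), whose slope exceeds L when m > 0. *)
Lemma le_slope_of_tangents f a b L : a <= b ->
    {within `[a, b], continuous f} ->
    (forall x, a < x < b -> exists s ds e, [/\ tangent_at s x ds, s x = f x,
       0 < e & forall h, `|h| < e -> s (x + h) <= f (x + h)]) ->
    (forall x d, a < x < b -> tangent_at f x d -> d <= L) ->
  f b - f a <= L * (b - a).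
Proof.
rewrite le_eqVlt => /predU1P[-> _ _ _|ab cf supp der]; first by rewrite !subrr mulr0.
pose g x := f x - f a - L * (x - a).
have cg : {within `[a, b], continuous g}.
  apply/subspace_continuousP => x xab.
  apply: cvgB; first apply: cvgB.
  - by have /subspace_continuousP := cf; apply.
  - exact: cvg_cst.
  - apply: cvgM; first exact: cvg_cst.
    by apply: cvgB; [exact: cvg_within|exact: cvg_cst].
pose G x := (b - x) * g x.
have cG : {within `[a, b], continuous G}.
  apply/subspace_continuousP => x xab; apply: cvgM.
    by apply: cvgB; [exact: cvg_cst|exact: cvg_within].
  by have /subspace_continuousP := cg; apply.
have [c cab cmax] := EVT_max (ltW ab) cG.
rewrite -subr_le0 -/(g b) leNgt; apply/negP => gb0.
have Gc0 : 0 < G c.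
  (* [G] vanishes at [b], so the positivity of [g b] is first carried by continuity to a point left
     of [b]. *)
  have [x /andP[ax xb] gx] : exists2 x, a <= x < b & 0 < g x.
    have /subspace_continuousP /(_ b) : {within `[a, b], continuous g} := cg.
    rewrite /= in_itv/= lexx (ltW ab) => /(_ isT) /cvgrPdist_lt /(_ _ gb0).
    rewrite near_withinE => /nbhs_ballP[/= e e0 be].
    pose x := b - Num.min (e / 2) (b - a).
    have xb : x < b by rewrite /x ltrBlDr ltrDl lt_min subr_gt0 ab divr_gt0.
    have ax : a <= x by rewrite /x lerBrDr -lerBrDl ge_min lexx orbT.
    exists x; first by rewrite ax.
    have := be x; rewrite /ball/= in_itv/= ax (ltW xb) => /(_ _ isT).
    rewrite gtr0_norm ?subr_gt0// => H.
    have /H : b - x < e.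
      by rewrite /x opprB addrC subrK gt_min; apply/orP; left; lra.
    by move/ltr_normlW => K; have {K} : g b - g x < g b := K; rewrite /g; lra.
  apply: lt_le_trans (cmax x _); last by rewrite in_itv/= ax ltW.
  by rewrite mulr_gt0// subr_gt0.
have ga : g a = 0 by rewrite /g !subrr mulr0 subr0.
have {cab}/andP[ac cb] : a < c < b.
  move: cab; rewrite in_itv/= => /andP[ac cb]; rewrite !lt_neqAle ac cb !andbT.
  apply/andP; split; apply/eqP => cE; move: Gc0.
    by rewrite -cE /G ga mulr0 ltxx.
  by rewrite cE /G subrr mul0r ltxx.
have bc0 : 0 < b - c by rewrite subr_gt0.
have gc0 : 0 < g c by move: Gc0; rewrite pmulr_rgt0.
have [s [ds [e [sc scE e0 se]]]] := supp c (introT andP (conj ac cb)).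
(* The bound [c - a] keeps [c + h] in the interval, and [(b - c) / 2] keeps [b - (c + h)] at least
   [(b - c) / 2]; the latter produces the factor 2 in the constant below. *)
pose e1 := Num.min e (Num.min (c - a) ((b - c) / 2)).
have e10 : 0 < e1 by rewrite !lt_min e0 subr_gt0 ac divr_gt0.
have tc : tangent_at f c (L + g c / (b - c)).
  apply: (tangent_at_between (C := 2 * g c / (b - c) ^+ 2) sc scE e10).
    by move=> h; rewrite lt_min => /andP[/se].
  move=> h; rewrite !lt_min => /and3P[_ /ltr_normlP[h1 h2] /ltr_normlP[h3 h4]].
  have : G (c + h) <= G c by apply: cmax; rewrite in_itv/=; apply/andP; split; lra.
  rewrite /G => Gle.
  have bch : 0 < b - (c + h) by lra.
  have {Gle} : g (c + h) <= (b - c) * g c / (b - (c + h)).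
    by rewrite ler_pdivlMr// mulrC.
  (* Exact Taylor expansion in [h] with remainder: the linear coefficient is the excess of the slope
     over [L]. *)
  have -> : (b - c) * g c / (b - (c + h)) =
      g c + g c / (b - c) * h + g c / (b - c) * h ^+ 2 / (b - (c + h)).
    by field; rewrite !lt0r_neq0.
  have : g c / (b - c) * h ^+ 2 / (b - (c + h)) <= 2 * g c / (b - c) ^+ 2 * h ^+ 2.
    have -> : 2 * g c / (b - c) ^+ 2 * h ^+ 2
        = g c / (b - c) * h ^+ 2 / ((b - c) / 2).
      by field; rewrite !lt0r_neq0.
    apply: ler_wpM2l; last by rewrite lef_pV2 ?posrE ?divr_gt0//; lra.
    by rewrite mulr_ge0 ?sqr_ge0// divr_ge0// ltW.
  rewrite {1}/g {1}/g; move: (g c / (b - c)) (2 * _ / _ * _) => p q.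
  by rewrite /g; lra.
have := der _ _ (introT andP (conj ac cb)) tc.
have : 0 < g c / (b - c) by rewrite divr_gt0.
by lra.
Qed.

(** The argument is reflected, not the value: replacing [f] by its negative would turn supports from
    below into supports from above. *)
Lemma ge_slope_of_tangents f a b L : a <= b ->
    {within `[a, b], continuous f} ->
    (forall x, a < x < b -> exists s ds e, [/\ tangent_at s x ds, s x = f x,
       0 < e & forall h, `|h| < e -> s (x + h) <= f (x + h)]) ->
    (forall x d, a < x < b -> tangent_at f x d -> - L <= d) ->
  f a - f b <= L * (b - a).
Proof.
move=> ab cf supp der.
have := @le_slope_of_tangents (f \o -%R) (- b) (- a) L.
rewrite lerN2 /= !opprK [- a + b]addrC; apply=> //.
- by apply: within_continuous_compN; rewrite !opprK.
- move=> x xab; have [|s [ds [e [sx sxE e0 se]]]] := supp (- x).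
    by rewrite ltrNr ltrNl andbC.
  exists (s \o -%R), (- ds), e; split=> //.
    by rewrite -[x]opprK; exact: tangent_at_comp_opp.
  by move=> h he /=; rewrite opprD; apply: se; rewrite normrN.
- move=> x d xab /tangent_at_comp_opp dx.
  rewrite -lerN2; apply: (der (- x)); first by rewrite ltrNr ltrNl andbC.
  by move: dx; rewrite (_ : (f \o -%R) \o -%R = f)//;
    apply: boolp.funext => y /=; rewrite opprK.
Qed.

End MeanValue.

(** * First-order Taylor estimate for a complex power series in a real variable *)

Section PowerSeries.
Local Open Scope complex_scope.
Variable R : realType.
Local Notation normc := (@Normc.normc R).

Lemma normc_ge0 (z : R[i]) : 0 <= normc z.
Proof. by case: z => x y; exact: sqrtr_ge0. Qed.

Lemma ler_normcD (y z : R[i]) : normc (y + z) <= normc y + normc z.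
Proof. by rewrite -lecR rmorphD; exact: (@ler_normD _ R[i]^o y z). Qed.

Lemma normc_distC (y z : R[i]) : normc (y - z) = normc (z - y).
Proof. by apply: (@complexI R); exact: (@distrC _ R[i]^o y z). Qed.

Lemma normc_real (x : R) : normc x%:C = `|x|.
Proof. by rewrite /= expr0n addr0 sqrtr_sqr. Qed.

Lemma ler_Re_normc (z : R[i]) : `|complex.Re z| <= normc z.
Proof. by rewrite -lecR; exact: normc_ge_Re. Qed.

Lemma ler_normc_sum (I : finType) (F : I -> R[i]) : normc (\sum_i F i) <= \sum_i normc (F i).
Proof.
apply: (big_ind2 (fun z x => normc z <= x)) => //; first by rewrite Normc.normc0.
by move=> y1 x1 y2 x2 H1 H2; rewrite (le_trans (ler_normcD _ _))// lerD.
Qed.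

Lemma cvg_entry m n (s : nat -> 'M[R[i]]_(m, n)) (l : 'M[R[i]]_(m, n)) i j (e : R) :
  s @ \oo --> l -> 0 < e ->
  exists N, forall k, (N <= k)%N -> normc (l i j - s k i j) < e.
Proof.
move=> sl e0.
have /cvgrPdist_lt /(_ e%:C) :=
  @cvg_comp _ _ _ _ _ _ _ _ sl (@coord_continuous _ m n i j l).
rewrite ltcR => /(_ e0) [N _ sN].
by exists N => k /sN /=; rewrite ltcR.
Qed.

(** Convergence at the single point [r] bounds [normc (a n) * r ^+ n], so for [|h| <= r / 2] the
    terms from degree 2 on are dominated by a geometric series of ratio 1/2. The set [D] allows for
    one-sided domains. *)
Lemma power_series_quadratic_remainder (a : nat -> R[i]) (S : R -> R[i]) (D : set R) (r : R) :
    0 < r -> D r -> D 0 ->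
    (forall h e, D h -> 0 < e -> exists N, forall k, (N <= k)%N ->
       normc (S h - \sum_(0 <= n < k) (h ^+ n)%:C * a n) < e) ->
  exists C, forall h, D h -> `|h| <= r / 2 ->
    normc (S h - S 0 - h%:C * a 1%N) <= C * h ^+ 2.
Proof.
move=> r0 Dr D0 Scvg.
have [M M0 aM] : exists2 M : R, 0 <= M & forall n, normc (a n) * r ^+ n <= M.
  have [N SN] := Scvg r 1 Dr ltr01.
  pose t n := normc (a n) * r ^+ n.
  have t0 n : 0 <= t n by rewrite mulr_ge0 ?normc_ge0// exprn_ge0// ltW.
  exists (2 + \sum_(n < N) t n); first by rewrite addr_ge0// sumr_ge0.
  move=> n; have [nN|Nn] := ltnP n N.
    rewrite (bigD1 (Ordinal nN))//= -/(t n).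
    have : 0 <= \sum_(i < N | i != Ordinal nN) t i by rewrite sumr_ge0.
    lra.
  (* From index [N] on, consecutive partial sums both lie within 1 of [S r], so their difference is
     at most 2. *)
  have : normc (a n) * r ^+ n <= 2.
    have -> : normc (a n) * r ^+ n = normc ((r ^+ n)%:C * a n).
      by rewrite Normc.normcM normc_real ger0_norm ?exprn_ge0 ?(ltW r0)// mulrC.
    have := SN _ Nn; have := SN _ (leqW Nn); rewrite big_nat_recr//=.
    set s := \sum_(0 <= _ < n) _; set z := _ * a n => H1 H2.
    have -> : z = (S r - s) + ((s + z) - S r) by ring.
    by have := ler_normcD (S r - s) (s + z - S r); rewrite (normc_distC (s + z)); lra.
  have : 0 <= \sum_(i < N) t i by rewrite sumr_ge0.
  lra.
pose C := 2 * M / r ^+ 2.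
have C0 : 0 <= C by rewrite divr_ge0 ?mulr_ge0 ?exprn_ge0 ?(ltW r0).
(* The factor [1 - 2^-1 ^+ n] is the closed form of the geometric sum; it makes the induction go
   through and is at most 1 in the limit. *)
have part h n : `|h| <= r / 2 ->
    normc (\sum_(0 <= k < n.+2) (h ^+ k)%:C * a k - a 0%N - h%:C * a 1%N) <=
    C * h ^+ 2 * (1 - 2^-1 ^+ n).
  move=> hr; elim: n => [|n IH].
    rewrite big_nat_recr//= big_nat1 expr0 expr1 mul1r.
    rewrite (_ : _ - _ - _ = 0); last by ring.
    by rewrite Normc.normc0 subrr mulr0.
  rewrite big_nat_recr//=.
  set s := \sum_(0 <= _ < _) _ in IH *; set z := _ * a n.+2.
  have -> : s + z - a 0%N - h%:C * a 1%N = (s - a 0%N - h%:C * a 1%N) + z by ring.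
  apply: le_trans (ler_normcD _ _) _.
  apply: le_trans (lerD IH (_ : _ <= C * h ^+ 2 * 2^-1 ^+ n.+1)) _; last first.
    by rewrite -mulrDr [2^-1 ^+ n.+1]exprSr; apply: ler_wpM2l; [rewrite mulr_ge0 ?sqr_ge0|lra].
  rewrite /z Normc.normcM normc_real normrX /C.
  have -> : `|h| ^+ n.+2 * normc (a n.+2) =
      (normc (a n.+2) * r ^+ n.+2) * (`|h| / r) ^+ n * (`|h| / r) ^+ 2.
    rewrite !expr_div_n -addn2 !exprD; field.
    by rewrite expf_neq0 ?(lt0r_neq0 r0).
  have q2 : `|h| / r <= 2^-1 by rewrite ler_pdivrMr//; lra.
  have q0 : 0 <= `|h| / r by rewrite divr_ge0// ltW.
  have -> : 2 * M / r ^+ 2 * h ^+ 2 * 2^-1 ^+ n.+1 =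
      M * 2^-1 ^+ n * (`|h| / r) ^+ 2.
    by rewrite [2^-1 ^+ n.+1]exprSr expr_div_n real_normK ?num_real//; field;
      rewrite ?expf_neq0 ?(lt0r_neq0 r0).
  apply: ler_wpM2r; first exact: sqr_ge0.
  apply: ler_pM => //; last by rewrite lerXn2r ?nnegrE ?invr_ge0.
    by rewrite mulr_ge0 ?normc_ge0// exprn_ge0// ltW.
  by rewrite exprn_ge0.
have lim h : D h -> `|h| <= r / 2 ->
    normc (S h - a 0%N - h%:C * a 1%N) <= C * h ^+ 2.
  move=> Dh hr; apply/ler_addgt0Pr => e e0.
  have [N SN] := Scvg h e Dh e0.
  have := SN N.+2 (leqW (leqnSn N)); have := part h N hr.
  set s := \sum_(0 <= _ < _) _ => H1 H2.
  have -> : S h - a 0%N - h%:C * a 1%N =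
    (s - a 0%N - h%:C * a 1%N) + (S h - s) by ring.
  apply: le_trans (ler_normcD _ _) _; apply: lerD (ltW H2).
  apply: le_trans H1 _; apply: ler_piMr; first by rewrite mulr_ge0 ?sqr_ge0.
  by rewrite gerBl exprn_ge0// invr_ge0.
have S0 : S 0 = a 0%N.
  have := lim 0 D0; rewrite normr0 divr_ge0 ?(ltW r0)// => /(_ isT).
  rewrite expr0n/= mulr0 mul0r subr0 => H.
  apply/subr0_eq/Normc.eq0_normc/le_anti; by rewrite H normc_ge0.
by exists C => h Dh hr; rewrite S0; exact: lim.
Qed.

End PowerSeries.

(** * Continuity, supports and slope bounds for the gain of an analytic matrix function *)

Section Gain.
Local Open Scope complex_scope.
Variables (R : realType) (m n : nat).
Local Notation normc := (@Normc.normc R).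

Lemma ler_Re_pairing (c A : 'M[R[i]]_(m, n)) : (forall i j, normc (c i j) <= 1) ->
  `|complex.Re (\sum_i \sum_j c i j * A i j)| <= \sum_i \sum_j normc (A i j).
Proof.
move=> c1; apply: le_trans (ler_Re_normc _) _; apply: le_trans (ler_normc_sum _) _.
apply: ler_sum => i _; apply: le_trans (ler_normc_sum _) _; apply: ler_sum => j _.
by rewrite Normc.normcM ler_piMl ?normc_ge0.
Qed.

(** The functional supporting [sigma_max] at [A] is at most [sigma_max B] at [B], and its
    coefficients are bounded by 1. *)
Lemma sigma_max_lipschitz (A B : 'M[R[i]]_(m, n)) :
  sigma_max A <= sigma_max B + \sum_i \sum_j normc (A i j - B i j).
Proof.
have [c [c1 <- /(_ B) cB]] := sigma_max_support A.
have := le_trans (ler_norm _) (ler_Re_pairing (A - B) c1).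
rewrite (eq_bigr (fun i => \sum_j c i j * A i j - \sum_j c i j * B i j)).
  rewrite sumrB raddfB/= lerBlDl => /le_trans; apply.
  rewrite lerD//; apply: ler_sum => i _; apply: ler_sum => j _.
  by rewrite !mxE.
by move=> i _; rewrite -sumrB; apply: eq_bigr => j _; rewrite !mxE mulrBr.
Qed.

Variable T : R -> 'M[R[i]]_(m, n).
Hypothesis analyticT : forall w0 : R, 0 <= w0 ->
  exists (r : R) (a : nat -> 'M[R[i]]_(m, n)), 0 < r /\
    forall w : R, 0 <= w -> `|w - w0| < r ->
      series (fun k => ((w - w0) ^+ k)%:C *: a k) @ \oo --> T w.

Lemma quadratic_remainder (x : R) : 0 <= x ->
  exists (D : 'M[R[i]]_(m, n)) (C e : R), 0 < e /\
    forall h, `|h| < e -> 0 <= x + h ->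
      \sum_i \sum_j normc (T (x + h) i j - T x i j - h%:C * D i j) <= C * h ^+ 2.
Proof.
move=> x0; have [r [a [r0 Ta]]] := analyticT x0.
have r20 : 0 < r / 2 by rewrite divr_gt0.
have entry (p : 'I_m * 'I_n) : exists C, forall h, 0 <= x + h /\ `|h| < r ->
    `|h| <= r / 2 / 2 ->
    normc (T (x + h) p.1 p.2 - T x p.1 p.2 - h%:C * a 1%N p.1 p.2) <= C * h ^+ 2.
  (* The series is used at the displacement [r / 2]: it is inside the radius [r], and being positive
     it stays in the half-line even when [x = 0]. *)
  have := @power_series_quadratic_remainder R (fun k => a k p.1 p.2)
    (fun h => T (x + h) p.1 p.2) (fun h => 0 <= x + h /\ `|h| < r) (r / 2) r20.
  rewrite addr0; apply.
  - by rewrite addr_ge0 ?(ltW r20)// gtr0_norm//; lra.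
  - by rewrite normr0.
  - move=> h e [xh hr] e0; have := Ta (x + h) xh.
    rewrite addrC addKr => /(_ hr) /(cvg_entry p.1 p.2) /(_ e0) [N SN].
    exists N => k /SN; rewrite /series/= summxE.
    rewrite (eq_bigr (fun l => (h ^+ l)%:C * a l p.1 p.2))// => l _.
    by rewrite mxE.
have [C CP] := choice entry.
exists (a 1%N), (\sum_i \sum_j C (i, j)), (r / 4); split; first by rewrite divr_gt0.
move=> h hr xh; rewrite mulr_suml; apply: ler_sum => i _.
rewrite mulr_suml; apply: ler_sum => j _.
by apply: (CP (i, j)); [split=> //|]; lra.
Qed.

Let phi x := sigma_max (T x).

Lemma gain_continuous a b : 0 <= a -> {within `[a, b], continuous phi}.
Proof.
move=> a0; apply/subspace_continuousP => x; rewrite /= in_itv/= => /andP[ax xb].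
have [D [C [e [e0 De]]]] := quadratic_remainder (le_trans a0 ax).
(* A local Lipschitz constant of [T] at [x]: for [|y - x| < 1] the quadratic remainder is at most
   linear. The summand 1 makes [K] positive for the division below. *)
pose K := `|C| + \sum_i \sum_j normc (D i j) + 1.
have K0 : 0 < K.
  rewrite ltr_wpDl// addr_ge0// sumr_ge0// => i _.
  by rewrite sumr_ge0// => j _; exact: normc_ge0.
have lip y : 0 <= y -> `|y - x| < Num.min e 1 ->
    \sum_i \sum_j normc (T y i j - T x i j) <= K * `|y - x|.
  rewrite lt_min => y0 /andP[ye y1].
  have := De _ ye; rewrite addrC subrK => /(_ y0) yD.
  have yC : C * (y - x) ^+ 2 <= `|C| * `|y - x|.
    apply: le_trans (ler_norm _) _; rewrite normrM ler_wpM2l//.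
    by rewrite normrX expr2 ler_piMl// ltW.
  have : \sum_i \sum_j normc (T y i j - T x i j) <=
     \sum_i \sum_j normc (T y i j - T x i j - (y - x)%:C * D i j)
     + (\sum_i \sum_j normc (D i j)) * `|y - x|.
    rewrite mulr_suml -big_split/=; apply: ler_sum => i _.
    rewrite mulr_suml -big_split/=; apply: ler_sum => j _.
    rewrite mulrC -normc_real -Normc.normcM; apply: le_trans (ler_normcD _ _).
    by rewrite subrK.
  by rewrite /K !mulrDl; have := normr_ge0 (y - x); lra.
apply/cvgrPdist_lt => d d0; rewrite near_withinE.
apply/nbhs_ballP; exists (Num.min (Num.min e 1) (d / K)) => /=.
  by rewrite !lt_min e0 ltr01 divr_gt0.
move=> y; rewrite /ball/= lt_min distrC => /andP[ye]; rewrite ltr_pdivlMr// mulrC => yd.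
rewrite in_itv/= => /andP[ay _].
have := le_lt_trans (lip y (le_trans a0 ay) ye) yd.
have := sigma_max_lipschitz (T x) (T y); have := sigma_max_lipschitz (T y) (T x).
have -> : \sum_i \sum_j normc (T x i j - T y i j) = \sum_i \sum_j normc (T y i j - T x i j).
  by apply: eq_bigr => i _; apply: eq_bigr => j _; rewrite normc_distC.
move=> yx xy Sd.
have h1 : phi x - phi y < d by rewrite ltrBlDl (le_lt_trans xy)// ltrD2l.
have h2 : phi y - phi x < d by rewrite ltrBlDl (le_lt_trans yx)// ltrD2l.
suff : `|phi x - phi y| < d by [].
by rewrite ltr_norml h1 ltrNl opprB h2.
Qed.

(** The functional supporting [sigma_max] at [T x] is frozen and composed with [T]. It lies below
    [phi] everywhere, so the radius 1 is arbitrary. *)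
Lemma gain_support x : 0 < x -> exists s ds e, [/\ tangent_at s x ds,
  s x = phi x, 0 < e & forall h, `|h| < e -> s (x + h) <= phi (x + h)].
Proof.
move=> x0; have [c [c1 cx cB]] := sigma_max_support (T x).
have [D [C [e [e0 De]]]] := quadratic_remainder (ltW x0).
exists (fun y => complex.Re (\sum_i \sum_j c i j * T y i j)),
  (complex.Re (\sum_i \sum_j c i j * D i j)), 1; split => //.
(* Staying within distance [x] keeps [x + h] nonnegative, where the expansion of [T] holds. *)
exists C, (Num.min e x); split; first by rewrite lt_min e0.
move=> h; rewrite lt_min => /andP[he /ltr_normlP[hx _]].
apply: le_trans (De h he _); last by lra.
pose A := T (x + h) - T x - h%:C *: D.
have -> : \sum_i \sum_j normc (T (x + h) i j - T x i j - h%:C * D i j) =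
    \sum_i \sum_j normc (A i j).
  by apply: eq_bigr => i _; apply: eq_bigr => j _; rewrite !mxE.
apply: le_trans (ler_Re_pairing A c1).
rewrite le_eqVlt; apply/orP; left; apply/eqP; congr `|_|.
have -> : \sum_i \sum_j c i j * A i j = \sum_i \sum_j c i j * T (x + h) i j
   - \sum_i \sum_j c i j * T x i j - h%:C * \sum_i \sum_j c i j * D i j.
  rewrite mulr_sumr -!sumrB; apply: eq_bigr => i _.
  rewrite mulr_sumr -!sumrB; apply: eq_bigr => j _.
  by rewrite !mxE; ring.
move: (\sum_i _) (\sum_i _) (\sum_i _) => [p p'] [q q'] [t t'] /=.
by ring.
Qed.

(** Dividing the quadratic remainder by [y - x] leaves an error of order [|y - x|]. This makes
    derivative bounds apply at the touching points of the mean value argument. *)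
Lemma tangent_at_has_deriv (f : R -> R) x d : tangent_at f x d -> has_deriv f x d.
Proof.
move=> [C [e [e0 fe]]]; apply/cvgrPdist_lt => r r0.
rewrite !near_withinE; apply/nbhs_ballP.
have C0 : 0 < `|C| + 1 by rewrite ltr_wpDl.
exists (Num.min e (r / (`|C| + 1))) => /=; first by rewrite lt_min e0 divr_gt0.
move=> y; rewrite /ball/= lt_min distrC => /andP[ye].
rewrite ltr_pdivlMr// => yr yx _.
have yx0 : y - x != 0 by rewrite subr_eq0.
have := fe _ ye; rewrite [x + _]addrC subrK => H.
have -> : d - (f y - f x) / (y - x) = - (f y - f x - d * (y - x)) / (y - x).
  by field.
rewrite normrM normrN normfV ltr_pdivrMr ?normr_gt0//.
apply: le_lt_trans H _; rewrite -real_normK ?num_real// expr2 mulrA.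
rewrite ltr_pM2r ?normr_gt0//; apply: le_lt_trans yr.
rewrite mulrC ler_wpM2l//; have := ler_norm C; lra.
Qed.

Lemma gain_slope (a b L : R) : 0 <= a -> a <= b ->
  (forall x d, a < x < b -> has_deriv phi x d -> `|d| <= L) ->
  phi b - phi a <= L * (b - a) /\ phi a - phi b <= L * (b - a).
Proof.
move=> a0 ab der.
have cphi := @gain_continuous a b a0.
have supp x : a < x < b -> exists s ds e, [/\ tangent_at s x ds,
    s x = phi x, 0 < e & forall h, `|h| < e -> s (x + h) <= phi (x + h)].
  by move=> /andP[ax _]; apply: gain_support; exact: le_lt_trans ax.
split; [apply: le_slope_of_tangents | apply: ge_slope_of_tangents] => // x d xab
  /tangent_at_has_deriv /(der _ _ xab); rewrite ler_norml => /andP[] //.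
Qed.

End Gain.

(** * From the grid condition to the bound at all frequencies *)

Theorem theorem3 (R : realType) (nz ny nw nu : nat)
  (P : R[i] -> 'M[R[i]]_(nz + ny, nw + nu))
  (K : R[i] -> 'M[R[i]]_(nu, ny))
  (stabK : exponentially_stabilizing P K)
  (analyticT : freq_real_analytic P K)
  (contT : freq_continuous_at_infty P K)
  (phi : \bar R -> R) (phiE : phi = freq_gain P K)
  (theta0 : R) (theta0_gt0 : 0 < theta0)
  (C2phi : C2_on [set w : R | 0 <= w /\ Hinf_norm P K - theta0 < phi w%:E]
                 (fun w => phi w%:E))
  (theta : R) (theta_gt0 : 0 < theta) (theta_le : theta <= theta0)
  (Omega_opt : seq (\bar R)) (opt_neq0 : Omega_opt <> [::])
  (opt_ge0 : forall w, w \in Omega_opt -> (0 <= w)%E)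
  (gamma : R) (gammaE : gamma = grid_max phi Omega_opt)
  (L : \bar R -> \bar R -> \bar R) (boundL : first_order_bound phi L)
  (N : nat) (omega : nat -> \bar R)
  (omega_first : omega 0%N = 0%E) (omega_last : omega N = +oo%E)
  (omega_lt : forall i, (i < N)%N -> (omega i < omega i.+1)%E)
  (opt_sub_ver : {subset Omega_opt <= [seq omega i | i <- iota 0 N.+1]})
  (grid : forall i, (i < N)%N ->
     (L (omega i) (omega i.+1) * (omega i.+1 - omega i)
      < (2 * gamma + 2 * theta - phi (omega i) - phi (omega i.+1))%:E)%E)
  (verif : grid_max phi [seq omega i | i <- iota 0 N.+1] - theta <= gamma) :
  Hinf_norm P K - theta <= gamma.
Proof.
have node i : (i <= N)%N -> phi (omega i) <= gamma + theta.
  move=> iN; rewrite -lerBlDr; apply: le_trans verif; rewrite lerD2r.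
  apply: (le_bigmax_seq 0 (omega i) xpredT) => //.
  by apply/mapP; exists i; rewrite ?mem_iota.
suff le w : (0 <= w)%E -> phi w <= gamma + theta.
  rewrite lerBlDr /Hinf_norm -phiE; apply: ge_sup.
    by exists (phi 0%E), 0%E => /=.
  by move=> _ [w w0 <-]; exact: le.
case: w => [w w0||]//; last by move=> _; rewrite -omega_last; exact: node.
(* Since the last node is infinite, every finite frequency lies below it; induction on the number of
   nodes locates its grid interval. *)
have [i [iN iw wi]] : exists i, [/\ (i < N)%N, (omega i <= w%:E)%E
    & (w%:E < omega i.+1)%E].
  have : (w%:E < omega N)%E by rewrite omega_last ltry.
  elim: (N) => [|k IH wk]; first by rewrite omega_first ltNge w0.
  have [/IH[i [ik]]|] := ltP w%:E (omega k); last by exists k.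
  by exists i; split=> //; exact: ltnW.
have slope a b l : 0 <= a -> a <= b ->
    (forall x d, a < x < b -> has_deriv (fun x => phi x%:E) x d -> `|d| <= l) ->
    phi b%:E - phi a%:E <= l * (b - a) /\ phi a%:E - phi b%:E <= l * (b - a).
  rewrite phiE.
  exact: (@gain_slope R nz nw (fun x => freq_response P K x%:E) analyticT a b l).
have Li := grid i iN; have nodei := node i (ltnW iN).
have [L0 bLi] : (0 <= L (omega i) (omega i.+1))%E /\ forall w d : R,
    (omega i <= w%:E <= omega i.+1)%E ->
    has_deriv (fun x => phi x%:E) w d -> (`|d|%:E <= L (omega i) (omega i.+1))%E.
  apply: boundL; last exact: omega_lt.
  elim: {iw wi Li nodei} i iN => [|i IH] iN; first by rewrite omega_first.
  exact: le_trans (IH (ltnW iN)) (ltW (omega_lt _ (ltnW iN))).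
have wi0 : (0 <= omega i)%E.
  elim: {iw wi Li nodei L0 bLi} i iN => [|i IH] iN; first by rewrite omega_first.
  exact: le_trans (IH (ltnW iN)) (ltW (omega_lt _ (ltnW iN))).
have nodeSi := node i.+1 iN.
move: (omega i) (omega i.+1) iw wi Li nodei L0 bLi wi0 nodeSi.
move=> [a| |] // b; rewrite lee_fin => aw wb Li nodei L0 bLi; rewrite lee_fin => a0 nodeb.
(* The interval has positive length, so an infinite [L] would make the left side of the grid
   condition infinite. *)
have L_fin : L a%:E b != +oo%E.
  apply/eqP => Loo; move: Li; rewrite Loo gt0_mulye//.
  by rewrite sube_gt0; exact: le_lt_trans wb.
move: (L a%:E b) L_fin L0 bLi Li => [l| |]// _; rewrite lee_fin => l0 bLi Li.
have der x d : a < x -> (x%:E < b)%E ->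
    has_deriv (fun y => phi y%:E) x d -> `|d| <= l.
  by move=> ax xb xd; rewrite -lee_fin; apply: bLi xd; rewrite lee_fin !ltW.
have [|leL _] := slope a w l a0 aw.
  by move=> x d /andP[ax xw]; apply: der => //; exact: lt_trans wb.
case: b wb Li nodeb der {bLi} => [b| |]// wb Li nodeb der.
(* Adding the slope bounds from both end points gives [2 * phi w <= phi a + phi b + l * (b - a)],
   which the grid condition puts below [2 * gamma + 2 * theta]. *)
- move: wb Li; rewrite lte_fin => wb; rewrite -EFinB -EFinM lte_fin => Li.
  have [|_ leR] := slope w b l (le_trans a0 aw) (ltW wb).
    move=> x d /andP[wx xb]; apply: der; rewrite ?lte_fin//.
    exact: le_lt_trans wx.
  by lra.
(* On the unbounded interval a positive [l] would make the product infinite; with [l = 0] the left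
   slope bound gives [phi w <= phi a]. *)
- move: l0; rewrite le_eqVlt => /predU1P[l0|l0].
    by move: leL; rewrite -l0 mul0r; lra.
  by move: Li; rewrite addye// gt0_muley// lte_fin.
Qed.
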